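(* Let $G=(V,E)$ be a graph and $\mathcal{C}$ a 2-coloring of $G$ with red degree sequence $d$. Then \[\dim\mathcal{A}(G,\mathcal{C})=\#E_d-\#V+b(V,E_d),\] where $b(V,E_d)$ denotes the number of bipartite connected components of the graph $(V,E_d)$.
   Context: Graphs are finite, undirected, may have parallel edges but no loops. A 2-coloring is $\mathcal{C}:E\to\{R,B\}$; its red degree sequence is $d=(d(v):v\in V)$ where $d(v)$ is the number of red edges at $v$. $\mathcal{K}(d)$ is the set of all 2-colorings of $G$ with red degree sequence $d$. The alternating cone $\mathcal{A}(G,\mathcal{C})\subseteq\mathbb{R}^E$ is the set of $x\ge0$ such that at each vertex the sum of $x$ over incident red edges equals the sum over incident blue edges. A closed alternating walk (CAW) is a walk $(v_0,e_1,v_1,\dots,e_m,v_m)$ with $v_0=v_m$, consecutive edges of different colors, and $\mathcal{C}(e_m)\ne\mathcal{C}(e_1)$. $E_d$ is the set of edges $e\in E$ such that some 2-coloring in $\mathcal{K}(d)$ has a CAW containing $e$ (isolated vertices count as bipartite components of $(V,E_d)$). *)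

(* Defs.v *)
(* Graphs with parallel edges, no loops:
   finite vertex type V, finite edge type E, endpoints src/tgt : E -> V
   with src e != tgt e.  A 2-coloring is C : E -> bool, true = red (R),
   false = blue (B). *)
From mathcomp Require Import all_boot all_algebra.
From mathcomp Require Import boolp.
Set Implicit Arguments. Unset Strict Implicit. Unset Printing Implicit Defensive.
Import GRing.Theory Num.Theory.

Section Graph.
Variables (V E : finType) (src tgt : E -> V).

Definition inc (e : E) (v : V) : bool := (src e == v) || (tgt e == v).

Definition joins (e : E) (x y : V) : bool :=
  ((src e == x) && (tgt e == y)) || ((src e == y) && (tgt e == x)).

Definition red_deg (C : E -> bool) (v : V) : nat := #|[set e | C e && inc e v]|.

Definition in_K (d : V -> nat) (C : E -> bool) : Prop := forall v, red_deg C v = d v.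

(* A walk (v0, e1, v1, ..., em, vm) is encoded by its start v0 and the
   sequence p = [:: (e1,v1); ...; (em,vm)]. *)
Fixpoint is_walk (x : V) (p : seq (E * V)) : bool :=
  if p is (e, y) :: p' then joins e x y && is_walk y p' else true.

(* closed alternating walk: m >= 1, closed (vm = v0), consecutive edges of
   different colours, and C(em) != C(e1)  (the wrap-around step of [cycle]) *)
Definition is_CAW (C : E -> bool) (v0 : V) (p : seq (E * V)) : bool :=
  [&& p != [::], is_walk v0 p, last v0 (map snd p) == v0
    & cycle (fun a b : E * V => C a.1 != C b.1) p].

Definition Ed (d : V -> nat) : {set E} :=
  [set e | `[< exists C : E -> bool, in_K d C /\
               exists (v0 : V) (p : seq (E * V)), is_CAW C v0 p /\ e \in map fst p >]].

Definition adjF (F : {set E}) : rel V := fun u w => [exists e in F, joins e u w].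

Definition componentsF (F : {set E}) : {set {set V}} :=
  [set [set w | connect (adjF F) v w] | v : V].

Definition bipartite_comp (F : {set E}) (K : {set V}) : bool :=
  [exists f : {ffun V -> bool},
     [forall e in F, (src e \in K) ==> (f (src e) != f (tgt e))]].

(* b(V,F): number of bipartite connected components (isolated vertices included) *)
Definition nb_bip (F : {set E}) : nat :=
  #|[set K in componentsF F | bipartite_comp F K]|.

Local Open Scope ring_scope.

Definition alt_cone (R : realFieldType) (C : E -> bool) (x : {ffun E -> R^o}) : Prop :=
  (forall e, 0 <= (x e : R)) /\
  forall v : V, \sum_(e | C e && inc e v) (x e : R) = \sum_(e | ~~ C e && inc e v) (x e : R).

End Graph.

(* dimension of a subset A of a finite-dimensional vector space (the dimension
   of its linear span): the maximal size of a linearly independent family in A *)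
Definition is_dim (R : fieldType) (vT : vectType R) (A : vT -> Prop) (k : nat) : Prop :=
  (exists s : seq vT, [/\ forall x, x \in s -> A x, free s & size s = k]) /\
  (forall s : seq vT, (forall x, x \in s -> A x) -> free s -> (size s <= k)%N).

(* Main.v *)
(** A vector of the alternating cone is a circulation on the digraph of states
    (vertex, colour of the next edge), so its support is covered by closed
    alternating walks of [C]; conversely the multiplicities of such a walk form
    a vector of the cone. If [C'] has the same red degrees as [C], the indicator
    [y] of the edges where the two colorings differ is in the cone of [C], and a
    vector [x] of the cone of [C'] becomes one of [C] by negating it on these
    edges and adding a large multiple of [y]. Hence [Ed] is the support of a
    single vector of the cone, and the cone spans the space of all balanced
    vectors supported in [Ed]. Up to signs this is the kernel of the unsigned
    incidence matrix of [(V, Ed)], of rank [#|V|] minus the number of bipartite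
    components. *)
Require Import Defs.
From mathcomp Require Import all_boot all_order all_algebra.
From mathcomp Require Import boolp ring.
Set Implicit Arguments. Unset Strict Implicit. Unset Printing Implicit Defensive.
Import Order.TTheory GRing.Theory Num.Theory.
Local Open Scope ring_scope.

(** * Balanced vectors, circulations on states, and closed alternating walks *)

Section Balance.
Variables (R : realFieldType) (V E : finType) (src tgt : E -> V).
Hypothesis loopless : forall e, src e != tgt e.
Implicit Types (C : E -> bool) (x : {ffun E -> R^o}) (F : {set E}).

Local Notation inc := (inc src tgt).
Local Notation joins := (joins src tgt).
Local Notation cone := (@alt_cone V E src tgt R).

Lemma inc_natr e v : (inc e v)%:R = (src e == v)%:R + (tgt e == v)%:R :> R.
Proof.
rewrite /Defs.inc; have := loopless e.
by case: (src e =P v) => [<-|_]; case: (tgt e =P _) => [->|_];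
  rewrite ?eqxx //= ?addr0 ?add0r.
Qed.

Lemma sum_inc (g : V -> R) e :
  \sum_v (inc e v)%:R * g v = g (src e) + g (tgt e).
Proof.
have sum_pick w : \sum_v (w == v)%:R * g v = g w.
  rewrite (bigD1 w) //= eqxx mul1r big1 ?addr0 // => v.
  by rewrite eq_sym => /negbTE ->; rewrite mul0r.
under eq_bigr do rewrite inc_natr mulrDl.
by rewrite big_split /= !sum_pick.
Qed.

Definition sg C e : R := (-1) ^+ C e.

Definition balance C x v : R := \sum_e sg C e * (inc e v)%:R * x e.

Lemma balanceE C x v :
  balance C x v = \sum_(e | ~~ C e && inc e v) (x e : R)
                  - \sum_(e | C e && inc e v) (x e : R).
Proof.
rewrite /balance (bigID C) /= addrC; congr (_ + _).
  rewrite [RHS]big_mkcondr; apply: eq_bigr => e /negbTE Ce /=.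
  by rewrite /sg Ce expr0 mul1r; case: (inc e v); rewrite ?mul1r ?mul0r.
rewrite -sumrN [RHS]big_mkcondr; apply: eq_bigr => e Ce /=.
by rewrite /sg Ce expr1 mulN1r; case: (inc e v); rewrite mulNr ?mul1r ?mul0r ?oppr0.
Qed.

Lemma alt_coneP C x :
  cone C x <-> (forall e, 0 <= (x e : R)) /\ (forall v, balance C x v = 0).
Proof.
split=> -[x_ge0 bal]; split=> // v.
  by rewrite balanceE bal subrr.
by have /eqP := bal v; rewrite balanceE subr_eq0 => /eqP.
Qed.

Lemma balanceD C x y v : balance C (x + y) v = balance C x v + balance C y v.
Proof.
rewrite /balance -big_split /=; apply: eq_bigr => e _.
by rewrite !ffunE mulrDr.
Qed.

Lemma balanceZ C a x v : balance C (a *: x) v = a * balance C x v.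
Proof.
rewrite /balance mulr_sumr; apply: eq_bigr => e _.
by rewrite !ffunE [RHS]mulrCA.
Qed.

Lemma alt_cone0 C : cone C 0.
Proof.
apply/alt_coneP; split=> [e|v]; first by rewrite ffunE.
by rewrite /balance big1 // => e _; rewrite ffunE mulr0.
Qed.

Lemma alt_coneD C x y : cone C x -> cone C y -> cone C (x + y).
Proof.
move=> /alt_coneP[x0 bx] /alt_coneP[y0 byy]; apply/alt_coneP; split=> [e|v].
  by rewrite ffunE addr_ge0.
by rewrite balanceD bx byy addr0.
Qed.

(* The state (v, c) of an alternating walk means: at v, the next edge has
   colour c. A vector of the alternating cone is a circulation on states. *)
Definition alt_step C x : rel (V * bool) := fun s t =>
  [exists e, [&& 0 < (x e : R), joins e s.1 t.1, C e == s.2 & t.2 == ~~ s.2]].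

(** No flow leaves the set of states reachable from [(tgt e, ~~ C e)], so by conservation none
    enters it. The arc of [e] out of [(src e, C e)] ends in this set and carries positive flow, so
    its tail lies there too. *)
Lemma cone_step_back C x e : cone C x -> 0 < (x e : R) ->
  connect (alt_step C x) (tgt e, ~~ C e) (src e, C e).
Proof.
move=> /alt_coneP[x_ge0 bal] xe_gt0.
pose g s : R := (connect (alt_step C x) (tgt e, ~~ C e) s)%:R.
(* An edge gives two arcs of states, one per direction; [t1] and [t2] are tail minus head of the
   indicator [g] along them. *)
pose t1 e' := g (src e', C e') - g (tgt e', ~~ C e').
pose t2 e' := g (tgt e', C e') - g (src e', ~~ C e').
have sum0 : \sum_e' - (x e' : R) * (t1 e' + t2 e') = 0.
  transitivity (\sum_v (g (v, false) - g (v, true)) * - balance C x v); last first.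
    by rewrite big1 // => v _; rewrite bal oppr0 mulr0.
  under [RHS]eq_bigr do rewrite mulrN /balance mulr_sumr -sumrN.
  rewrite exchange_big; apply: eq_bigr => e' _ /=.
  rewrite mulNr sumrN; congr (- _).
  transitivity (sg C e' * (x e' : R) *
      (\sum_v (inc e' v)%:R * (g (v, false) - g (v, true)))).
    by rewrite sum_inc /sg /t1 /t2; case: (C e') => /=; ring.
  rewrite mulr_sumr; apply: eq_bigr => v _.
  by ring.
have stepg s t e' : 0 < (x e' : R) -> joins e' s t -> g (s, C e') <= g (t, ~~ C e').
  move=> xe' J; rewrite /g ler_nat.
  case: (boolP (connect _ _ (s, C e'))) => //= cs.
  rewrite (connect_trans cs) // connect1 //.
  by apply/existsP; exists e'; rewrite xe' J !eqxx.
have J12 e' : joins e' (src e') (tgt e') by rewrite /Defs.joins !eqxx.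
have J21 e' : joins e' (tgt e') (src e') by rewrite /Defs.joins !eqxx orbT.
have le1 e' : 0 < (x e' : R) -> t1 e' <= 0.
  by move=> h; rewrite subr_le0 stepg.
have le2 e' : 0 < (x e' : R) -> t2 e' <= 0.
  by move=> h; rewrite subr_le0 stepg.
have term_ge0 e' : 0 <= - (x e' : R) * (t1 e' + t2 e').
  have := x_ge0 e'; rewrite le_eqVlt => /orP[/eqP <-|h]; first by rewrite oppr0 mul0r.
  apply: mulr_le0; first by rewrite oppr_le0 ltW.
  by rewrite -[0]addr0 lerD ?le1 ?le2.
(* A vanishing sum of nonnegative terms forces [t1 e + t2 e = 0]; as both are at most 0, [g] takes
   the same value at both ends of the arc. *)
have /eqP := sum0; rewrite psumr_eq0 // => /allP/(_ e).
rewrite mem_index_enum => /(_ isT) /=.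
rewrite mulf_eq0 oppr_eq0 gt_eqF //= => /eqP t12.
have : 0 <= t1 e by rewrite -t12 gerDl le2.
rewrite subr_ge0 /g connect0 ler_nat.
by case: connect.
Qed.

Local Notation alt C := (fun a b : E * V => C a.1 != C b.1).

(** The walk may be empty, so the colors at its ends are expressed through an arbitrary preceding
    entry [a] of the color opposite to [s.2]. *)
Lemma alt_walk_of_connect C x s t : connect (alt_step C x) s t ->
  exists p, [/\ is_walk src tgt s.1 p, last s.1 (map snd p) = t.1 &
    forall a, C a.1 = ~~ s.2 -> path (alt C) a p /\ C (last a p).1 = ~~ t.2].
Proof.
case/connectP=> q + ->; elim: q s => [|r q IH] s /=.
  by move=> _; exists [::]; split.
case/andP=> /existsP[e /and4P[_ J /eqP Ce /eqP r2]] /IH[p [w l h]].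
exists ((e, r.1) :: p) => /=; rewrite J w; split=> // a Ca.
have [|-> ->] := h (e, r.1); first by rewrite r2 negbK.
by rewrite Ca Ce; case: (s.2).
Qed.

Lemma CAW_of_cone C x e : cone C x -> 0 < (x e : R) ->
  exists v p, is_CAW src tgt C v p /\ e \in map fst p.
Proof.
move=> xC xe; have [p [w l h]] := alt_walk_of_connect (cone_step_back xC xe).
exists (src e), ((e, tgt e) :: p); rewrite /= inE eqxx; split=> //.
have [/= |h1 h2] := h (e, tgt e); first by rewrite negbK.
rewrite /is_CAW /= w l eqxx /Defs.joins !eqxx /=.
by rewrite rcons_path h1 h2 /=; case: (C e).
Qed.

Definition walk_mult (p : seq (E * V)) : {ffun E -> R^o} :=
  [ffun e => (count_mem e (map fst p))%:R].

Lemma balance_walk_mult C p v :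
  balance C (walk_mult p) v = \sum_(b <- p) sg C b.1 * (inc b.1 v)%:R.
Proof.
rewrite /balance; under eq_bigr do rewrite ffunE.
elim: p => [|b p IH]; first by rewrite big_nil big1 // => e _; rewrite mulr0.
rewrite big_cons -IH; under eq_bigr do rewrite /= natrD mulrDr.
rewrite big_split /=; congr (_ + _).
rewrite (bigD1 b.1) //= eqxx mulr1 big1 ?addr0 // => e.
by rewrite eq_sym => /negbTE ->; rewrite mulr0.
Qed.

Lemma joins_inc e u w v : joins e u w ->
  (inc e v)%:R = (u == v)%:R + (w == v)%:R :> R.
Proof.
by rewrite inc_natr => /orP[] /andP[/eqP -> /eqP ->] //; rewrite addrC.
Qed.

(** The sum telescopes: at each inner vertex two consecutive edges contribute opposite signs, and
    only the two ends of the walk remain. *)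
Lemma sum_alt_walk C v u a p : is_walk src tgt u p -> path (alt C) a p ->
  \sum_(b <- p) sg C b.1 * (inc b.1 v)%:R
  = sg C (last a p).1 * (last u (map snd p) == v)%:R - sg C a.1 * (u == v)%:R.
Proof.
elim: p u a => [|[e w] p IH] u a /=; first by rewrite big_nil subrr.
case/andP=> J W /andP[Cae P]; rewrite big_cons (IH w (e, w)) //= (joins_inc v J).
have -> : sg C a.1 = - sg C e.
  by move: Cae; rewrite /sg; case: (C _); case: (C _); rewrite ?opprK.
by rewrite mulNr opprK mulrDr addrC -addrA; congr (_ + _); rewrite addrCA addNr addr0.
Qed.

Lemma cone_walk_mult C v p : is_CAW src tgt C v p -> cone C (walk_mult p).
Proof.
case/and4P; case: p => // b p _ W /eqP L cyc.
apply/alt_coneP; split=> [e|w]; first by rewrite ffunE ler0n.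
(* The last edge serves as the one preceding the first, so the two end terms cancel. *)
move: cyc; rewrite (cycle_path b) => P.
rewrite balance_walk_mult (sum_alt_walk w W P).
by rewrite [last _ (b :: p)]/= -[in X in _ - X]L subrr.
Qed.

(** * Recolorings with the same red degrees *)

Lemma balance_recolor C C' x v :
  balance C [ffun e => sg C e * sg C' e * (x e : R)] v = balance C' x v.
Proof.
apply: eq_bigr => e _; rewrite ffunE /sg.
by case: (C e); case: (C' e); rewrite ?expr1 ?expr0 !(mulN1r, mul1r, mulr1, mulNr, mulrN, opprK).
Qed.

Definition diff_color C C' : {ffun E -> R^o} := [ffun e => (C e != C' e)%:R].

Lemma red_deg_natr C v : (red_deg src tgt C v)%:R = \sum_(e | inc e v) (C e)%:R :> R.
Proof.
rewrite /red_deg cardsE -sum1_card natr_sum big_mkcond [RHS]big_mkcond /=.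
by apply: eq_bigr => e _; rewrite unfold_in; case: (C e); case: (inc e v).
Qed.

(** At each vertex the balance is the number of edges turned red minus the number turned blue, which
    is the difference of the two red degrees. *)
Lemma cone_diff_color C C' : red_deg src tgt C =1 red_deg src tgt C' ->
  cone C (diff_color C C').
Proof.
move=> deg; apply/alt_coneP; split=> [e|v]; first by rewrite ffunE ler0n.
transitivity ((red_deg src tgt C' v)%:R - (red_deg src tgt C v)%:R : R); last first.
  by rewrite deg subrr.
rewrite !red_deg_natr -sumrB [RHS]big_mkcond; apply: eq_bigr => e _.
rewrite ffunE /sg; case: (inc e v); rewrite ?mulr0 ?mul0r //.
by case: (C e); case: (C' e); rewrite /= ?expr1 ?expr0 !(mulr1, mulr0, mul1r, subrr, subr0, sub0r).
Qed.

(** This removes the quantification over colorings from [Ed]: the cone of [C] alone detects every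
    edge. *)
Lemma EdP C e :
  reflect (exists2 x, cone C x & 0 < (x e : R)) (e \in Ed src tgt (red_deg src tgt C)).
Proof.
apply: (iffP idP); last first.
  case=> x xC xe; rewrite inE; apply/asboolP; exists C; split=> //.
  exact: CAW_of_cone xC xe.
rewrite inE => /asboolP[C' [deg [v [p [W ep]]]]].
have /alt_coneP[_ bal] := cone_walk_mult W.
have /alt_coneP[_ bald] : cone C (diff_color C C').
  by apply: cone_diff_color => w; rewrite deg.
set x := walk_mult p in bal.
have x_ge0 e' : 0 <= (x e' : R) by rewrite ffunE ler0n.
have xe : 0 < (x e : R) by rewrite ffunE ltr0n -has_count has_pred1.
(* The added 1 makes [N] strictly larger than every coordinate of [x], so [N - x e] is positive
   where the colorings differ. *)
pose N : R := 1 + \sum_e' (x e' : R).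
have ltN e' : (x e' : R) < N.
  rewrite /N (bigD1 e') //= addrCA ltrDl ltr_wpDr //.
  by apply: sumr_ge0.
pose z : {ffun E -> R^o} := [ffun e => sg C e * sg C' e * (x e : R)].
have zE e' : ((z + N *: diff_color C C') e' : R) =
    if C e' == C' e' then x e' else N - (x e' : R).
  rewrite !ffunE /sg; case: (C e'); case: (C' e');
  by rewrite /= ?expr1 ?expr0 ?mulN1r ?mulrN1 ?opprK ?mulN1r ?mul1r ?scaler0 ?addr0 //
    [_ *: _]mulr1 addrC.
exists (z + N *: diff_color C C').
  apply/alt_coneP; split=> [e'|w].
    by rewrite zE; case: ifP => // _; rewrite subr_ge0 ltW.
  by rewrite balanceD balanceZ bald mulr0 addr0 balance_recolor bal.
by rewrite zE; case: ifP => // _; rewrite subr_gt0.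
Qed.

Lemma cone_full_support C : exists2 w, cone C w &
  forall e, e \in Ed src tgt (red_deg src tgt C) -> 0 < (w e : R).
Proof.
have : forall e, exists x, cone C x /\
    (e \in Ed src tgt (red_deg src tgt C) -> 0 < (x e : R)).
  move=> e; case: (EdP C e) => [[x xC xe]|_]; first by exists x.
  (* The zero vector is a filler for edges outside [Ed]. *)
  by exists 0; split=> //; apply: alt_cone0.
case/choice=> f fP; exists (\sum_e f e).
  elim/big_ind: _ => [|x y|e _]; [exact: alt_cone0|exact: alt_coneD|].
  by case: (fP e).
move=> e eE; rewrite sum_ffunE (bigD1 e) //= ltr_wpDr ?(fP e).2 //.
by apply: sumr_ge0 => e' _; case: (fP e') => -[].
Qed.

End Balance.

(** * Rank of the unsigned incidence matrix *)

Section IncidenceRank.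
Variables (R : realFieldType) (V E : finType) (src tgt : E -> V).
Hypothesis loopless : forall e, src e != tgt e.
Variable F : {set E}.
Implicit Types K : {set V}.

Local Notation adj := (adjF src tgt F).
Local Notation bip_comps :=
  [set K in componentsF src tgt F | bipartite_comp src tgt F K].

Lemma adj_edge e : e \in F -> adj (src e) (tgt e).
Proof. by move=> eF; apply/existsP; exists e; rewrite eF /joins !eqxx. Qed.

Lemma connect_adj_eq (T : eqType) (g : V -> T) u w :
  (forall e, e \in F -> g (src e) = g (tgt e)) -> connect adj u w -> g u = g w.
Proof.
move=> gF uw; apply/eqP; rewrite eq_sym.
have cl : closed adj [pred v | g v == g u].
  move=> v v' /existsP[e /andP[eF J]]; rewrite !inE.
  by case/orP: J => /andP[/eqP <- /eqP <-]; rewrite (gF e eF).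
by have := closed_connect cl uw; rewrite !inE eqxx.
Qed.

Lemma adj_sym : connect_sym adj.
Proof.
apply: sym_connect_sym => u v; apply: eq_existsb => e.
by rewrite /joins orbC.
Qed.

Definition comp v := [set w | connect adj v w].

Lemma comp_eq K v : K \in componentsF src tgt F -> v \in K -> K = comp v.
Proof.
case/imsetP=> u _ ->; rewrite inE => uv; apply/setP=> w.
by rewrite !inE (same_connect adj_sym uv).
Qed.

Lemma comp_edge K e : K \in componentsF src tgt F -> e \in F ->
  (src e \in K) = (tgt e \in K).
Proof.
case/imsetP=> u _ -> eF; rewrite !inE.
exact: (same_connect1r adj_sym (adj_edge eF)).
Qed.

Definition col K : {ffun V -> bool} :=
  odflt [ffun=> false] [pick f : {ffun V -> bool} |
    [forall e in F, (src e \in K) ==> (f (src e) != f (tgt e))]].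

Lemma colP K e : bipartite_comp src tgt F K -> e \in F -> src e \in K ->
  col K (src e) != col K (tgt e).
Proof.
rewrite /col; case: pickP => [f fP _ eF eK|no /existsP[f]]; last by rewrite no.
by have /forall_inP/(_ e eF)/implyP/(_ eK) := fP.
Qed.

(** For a bipartite component, this is the vector with values 1 and -1 on its two sides, which the
    unsigned incidence matrix annihilates. *)
Definition signK K v : R := if v \in K then (-1) ^+ col K v else 0.

Lemma signK_edge K e : K \in bip_comps -> e \in F ->
  signK K (src e) + signK K (tgt e) = 0.
Proof.
rewrite inE => /andP[Kc Kb] eF; rewrite /signK -(comp_edge Kc eF).
case: ifP => [eK|_]; last by rewrite addr0.
by have := colP Kb eF eK; case: (col K _); case: (col K _) => // _;
  rewrite ?addNr ?addrN.
Qed.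

Lemma signK_sqr (K : {set V}) v : v \in K -> signK K v * signK K v = 1.
Proof. by rewrite /signK => ->; rewrite -expr2 sqrr_sign. Qed.

Definition inc_mx : 'M[R]_(#|F|, #|V|) :=
  \matrix_(i, j) (inc src tgt (enum_val i) (enum_val j))%:R.

Definition sign_mx : 'M[R]_(#|bip_comps|, #|V|) :=
  \matrix_(i, j) signK (enum_val i) (enum_val j).

Lemma sum_enum_val (T : finType) (g : T -> R) :
  \sum_i g i = \sum_(i < #|T|) g (enum_val i).
Proof. by rewrite -big_enum_val; apply: eq_bigl. Qed.

Lemma mul_inc_tr (u : 'rV_#|V|) i :
  (u *m inc_mx^T) 0 i = u 0 (enum_rank (src (enum_val i)))
                        + u 0 (enum_rank (tgt (enum_val i))).
Proof.
rewrite -(sum_inc loopless (fun v => u 0 (enum_rank v))) mxE [RHS]sum_enum_val.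
by apply: eq_bigr => j _; rewrite !mxE enum_valK mulrC.
Qed.

(** Distinct components are disjoint and nonempty, so evaluating a vanishing combination at a vertex
    of one component isolates its coefficient. *)
Lemma sign_mx_free : row_free sign_mx.
Proof.
apply: inj_row_free => u u0; apply/rowP=> i; rewrite mxE.
have := enum_valP i; set K := enum_val i => Kb.
have [Kc _] : K \in componentsF src tgt F /\ bipartite_comp src tgt F K.
  by move: Kb; rewrite inE => /andP.
have [v vK] : exists v, v \in K.
  by case/imsetP: Kc => v _ ->; exists v; rewrite inE connect0.
have /rowP/(_ (enum_rank v)) := u0; rewrite !mxE (bigD1 i) //= big1 => [|j ji].
  rewrite addr0 mxE enum_rankK /signK vK => /eqP.
  by rewrite mulf_eq0 signr_eq0 orbF => /eqP.
rewrite mxE enum_rankK /signK ifN ?mulr0 //; apply: contraNN ji => vj.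
apply/eqP/enum_val_inj; rewrite -/K (comp_eq Kc vK).
by apply: comp_eq vj; have := enum_valP j; rewrite inE => /andP[].
Qed.

Lemma sub_sign_ker : (sign_mx <= kermx inc_mx^T)%MS.
Proof.
apply/sub_kermxP/row_matrixP=> k; apply/rowP=> i.
rewrite row_mul mul_inc_tr !mxE !enum_rankK.
by apply: signK_edge; apply: enum_valP.
Qed.

(* On a component, a potential with [y u + y w = 0] along edges has constant
   absolute value, and its sign is a proper 2-coloring unless it vanishes. *)
Lemma sub_ker_sign : (kermx inc_mx^T <= sign_mx)%MS.
Proof.
apply/rV_subP=> y /sub_kermxP y0.
pose g v := y 0 (enum_rank v).
have gF e : e \in F -> g (src e) = - g (tgt e).
  move=> eF; apply/eqP; rewrite -addr_eq0.
  have /rowP/(_ (enum_rank_in eF e)) := y0.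
  by rewrite mul_inc_tr enum_rankK_in // mxE => ->.
have gs K u w : K \in bip_comps -> connect adj u w ->
    g u * signK K u = g w * signK K w.
  move=> Kb; apply: (connect_adj_eq (g := fun v => g v * signK K v)) => e eF.
  by have /eqP := signK_edge Kb eF; rewrite addr_eq0 gF // => /eqP ->; rewrite mulrNN.
have g0 v : comp v \notin bip_comps -> g v = 0.
  apply: contraNeq => gv; rewrite inE imset_f //=.
  apply/existsP; exists [ffun w => 0 < g w]; apply/forall_inP=> e eF.
  apply/implyP; rewrite inE !ffunE => ve.
  have : `|g v| = `|g (src e)|.
    by apply: (connect_adj_eq (g := fun v => `|g v|)) ve => e' /gF ->; rewrite normrN.
  move/eqP; rewrite gF // normrN => /eqP gve.
  have : g (tgt e) != 0 by rewrite -normr_eq0 -gve normr_eq0.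
  by rewrite oppr_gt0; case: ltrgt0P.
have pickK (i : 'I_#|bip_comps|) : exists v, v \in (enum_val i : {set V}).
  have := enum_valP i; rewrite inE => /andP[/imsetP[v _ ->] _].
  by exists v; rewrite inE connect0.
have /choice[r rP] := pickK.
(* By [gs] this coefficient does not depend on the representative [r i]; multiplying it by the sign
   at [v] gives back [g v], since signs square to 1. *)
apply/submxP; exists (\row_i (g (r i) * signK (enum_val i) (r i))).
apply/rowP=> j; rewrite mxE; set v := enum_val j.
have -> : y 0 j = g v by rewrite /g enum_valK.
have inK (i : 'I_#|bip_comps|) : v \in (enum_val i : {set V}) -> enum_val i = comp v.
  by apply: comp_eq; have := enum_valP i; rewrite inE => /andP[].
have [vb|vb] := boolP (comp v \in bip_comps); last first.
  rewrite g0 // big1 // => i _; rewrite !mxE -/v [signK _ v]/signK ifN ?mulr0 //.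
  by apply: contra vb => /inK <-; apply: enum_valP.
pose i := enum_rank_in vb (comp v).
have iE : enum_val i = comp v by rewrite enum_rankK_in.
rewrite (bigD1 i) //= big1 ?addr0 => [|k ki].
  rewrite !mxE -/v iE -(gs _ v _ vb) ?mulrAC.
    by rewrite -mulrA signK_sqr ?mulr1 // inE connect0.
  by have := rP i; rewrite iE inE.
rewrite !mxE -/v [signK _ v]/signK ifN ?mulr0 //.
by apply: contra ki => /inK kE; apply/eqP/enum_val_inj; rewrite kE iE.
Qed.

Lemma rank_inc_mx : (\rank inc_mx + nb_bip src tgt F)%N = #|V|.
Proof.
have kerE : (kermx inc_mx^T :=: sign_mx)%MS.
  by apply/eqmxP; rewrite sub_ker_sign sub_sign_ker.
have -> : nb_bip src tgt F = \rank (kermx inc_mx^T).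
  by rewrite kerE (eqP sign_mx_free).
by rewrite mxrank_ker mxrank_tr subnKC // -mxrank_tr rank_leq_row.
Qed.

End IncidenceRank.

(** * The span of the cone and its dimension *)

Section Dimension.
Variables (R : realFieldType) (V E : finType) (src tgt : E -> V).
Hypothesis loopless : forall e, src e != tgt e.
Variable C : E -> bool.
Implicit Types x : {ffun E -> R^o}.

Local Notation cone := (@alt_cone V E src tgt R C).
Local Notation EdC := (Ed src tgt (red_deg src tgt C)).
Local Notation M := (inc_mx R src tgt EdC).

Definition supp_balanced (x : {ffun E -> R^o}) : Prop :=
  (forall e, e \notin EdC -> x e = 0) /\ forall v, balance src tgt C x v = 0.

Lemma cone_supp_balanced x : cone x -> supp_balanced x.
Proof.
move=> xC; have [x_ge0 bal] := (alt_coneP _ _ C x).1 xC; split=> // e.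
apply: contraNeq => xe; apply/(EdP R loopless C e).
by exists x; rewrite // lt0r xe x_ge0.
Qed.

(** The sign twist turns the balance conditions, which depend on the coloring, into the left kernel
    of the unsigned incidence matrix. *)
Definition edge_coords (x : {ffun E -> R^o}) : 'rV[R]_#|EdC| :=
  \row_i (sg R C (enum_val i) * x (enum_val i)).

Lemma mul_edge_coords x j : (forall e, e \notin EdC -> x e = 0) ->
  (edge_coords x *m M) 0 j = balance src tgt C x (enum_val j).
Proof.
move=> x0; rewrite mxE /balance [RHS](bigID (mem EdC)) /= [X in _ + X]big1 => [|e /x0 ->];
  last by rewrite mulr0.
rewrite addr0 [RHS]big_enum_val; apply: eq_bigr => i _.
by rewrite !mxE mulrAC.
Qed.

(** Inverse twist with extension by zero: the sum selects the coordinate of [e], and is empty of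
    nonzero terms when [e] lies outside [Ed]. *)
Definition of_coords (u : 'rV[R]_#|EdC|) : {ffun E -> R^o} :=
  [ffun e => sg R C e * \sum_i (enum_val i == e)%:R * u 0 i].

Lemma of_coords_supp u e : e \notin EdC -> of_coords u e = 0.
Proof.
move=> eF; rewrite ffunE big1 ?mulr0 // => i _.
case: eqP => [ie|]; last by rewrite mul0r.
by have := enum_valP i; rewrite ie (negbTE eF).
Qed.

Lemma of_coordsK : cancel of_coords edge_coords.
Proof.
move=> u; apply/rowP=> i; rewrite !mxE ffunE mulrA -expr2 sqrr_sign mul1r.
rewrite (bigD1 i) //= eqxx mul1r big1 ?addr0 // => j ji.
by rewrite (inj_eq enum_val_inj) (negbTE ji) mul0r.
Qed.

Lemma edge_coords_sum n (k : 'I_n -> R) (x : 'I_n -> {ffun E -> R^o}) :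
  edge_coords (\sum_i k i *: x i) = \sum_i k i *: edge_coords (x i).
Proof.
apply/rowP=> j; rewrite mxE sum_ffunE summxE mulr_sumr; apply: eq_bigr => i _.
by rewrite !mxE !ffunE mulrCA.
Qed.

Lemma edge_coords_eq0 x : (forall e, e \notin EdC -> x e = 0) ->
  edge_coords x = 0 -> x = 0.
Proof.
move=> x0 /rowP c0; apply/ffunP=> e; rewrite [RHS]ffunE.
have [eF|/x0//] := boolP (e \in EdC).
have := c0 (enum_rank_in eF e); rewrite !mxE enum_rankK_in // => /eqP.
by rewrite mulf_eq0 signr_eq0 => /eqP.
Qed.

(** [edge_coords] is linear and injective on vectors supported in [Ed], so a free family becomes
    independent rows in the kernel. *)
Lemma size_free_balanced (s : seq {ffun E -> R^o}) :
  (forall x, x \in s -> supp_balanced x) -> free s ->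
  (size s <= \rank (kermx M))%N.
Proof.
move=> sW sfree; pose t := in_tuple s.
have tW (i : 'I_(size s)) : supp_balanced t`_i by apply: sW; rewrite mem_nth.
pose A : 'M[R]_(size s, #|EdC|) := \matrix_i edge_coords t`_i.
have Afree : row_free A.
  apply: inj_row_free => u; rewrite mulmx_sum_row.
  under eq_bigr do rewrite rowK.
  rewrite -edge_coords_sum => /edge_coords_eq0 u0.
  apply/rowP=> i; rewrite mxE.
  apply: (freeP (X := t) sfree (fun i => u 0 i)); apply: u0 => e eF.
  rewrite sum_ffunE big1 // => j _.
  by rewrite ffunE (tW j).1 // scaler0.
rewrite -(eqP Afree); apply/mxrankS/row_subP=> i; rewrite rowK.
apply/sub_kermxP/rowP=> j; rewrite mul_edge_coords ?(tW i).2 ?mxE //.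
exact: (tW i).1.
Qed.

Lemma free_balanced_exists : exists s : seq {ffun E -> R^o},
  [/\ forall x, x \in s -> supp_balanced x, free s & size s = \rank (kermx M)].
Proof.
pose B := row_base (kermx M).
pose t := [tuple of_coords (row i B) | i < \rank (kermx M)].
exists t; split; last by rewrite size_tuple.
- move=> x /mapP[i _ ->]; split=> [|v]; first exact: of_coords_supp.
  have := mul_edge_coords (enum_rank v) (of_coords_supp (row i B)).
  rewrite enum_rankK of_coordsK => <-.
  have /sub_kermxP -> : (row i B <= kermx M)%MS.
    by apply: submx_trans (row_sub _ _) _; rewrite eq_row_base.
  by rewrite mxE.
apply/freeP=> k kt.
have : \row_i k i *m B = 0.
  rewrite mulmx_sum_row.
  transitivity (edge_coords (\sum_i k i *: t`_i)); last first.
    by rewrite kt; apply/rowP=> j; rewrite !mxE ffunE mulr0.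
  rewrite edge_coords_sum; apply: eq_bigr => i _.
  by rewrite mxE -tnth_nth tnth_mktuple of_coordsK.
move/eqP; rewrite mulmx_free_eq0 ?row_base_free // => /eqP/rowP k0 i.
by have := k0 i; rewrite !mxE.
Qed.

Lemma balanced_cone_diff x : supp_balanced x ->
  exists y z, [/\ cone y, cone z & x = y - z].
Proof.
case=> x0 bal; have [w wC w_gt0] := cone_full_support R loopless C.
have [w_ge0 balw] := (alt_coneP _ _ C w).1 wC.
(* For [e] in [Ed] the summand at [e] alone gives [N * w e] at least the absolute value of [x e];
   outside [Ed] the numerator is 0. *)
pose N : R := \sum_e `|x e : R| / w e.
have N_ge0 : 0 <= N by apply: sumr_ge0 => e _; rewrite mulr_ge0 ?invr_ge0.
have NwC : cone (N *: w).
  apply/alt_coneP; split=> [e|v]; first by rewrite ffunE mulr_ge0.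
  by rewrite balanceZ balw mulr0.
exists (x + N *: w), (N *: w); split; rewrite ?addrK //.
apply/alt_coneP; split=> [e|v]; last by rewrite balanceD balanceZ bal balw mulr0 addr0.
have [eF|eF] := boolP (e \in EdC); last first.
  by rewrite !ffunE x0 // add0r mulr_ge0.
have : `|x e : R| <= N * w e.
  rewrite -ler_pdivrMr ?w_gt0 // /N (bigD1 e) //= lerDl.
  by apply: sumr_ge0 => e' _; rewrite mulr_ge0 ?invr_ge0.
rewrite !ffunE ler_norml => /andP[h _].
by rewrite -lerBlDr sub0r.
Qed.

Lemma is_dim_cone : is_dim cone (\rank (kermx M)).
Proof.
have bound s : (forall x, x \in s -> cone x) -> free s ->
    (size s <= \rank (kermx M))%N.
  by move=> sC; apply: size_free_balanced => x /sC; apply: cone_supp_balanced.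
split=> //.
(* A free family of maximal size inside the cone spans the cone, hence also all differences of cone
   vectors, which include every balanced vector supported in [Ed]. *)
pose P n := `[< exists s : seq {ffun E -> R^o},
  [/\ forall x, x \in s -> cone x, free s & size s = n] >].
have P0 : exists n, P n by exists 0%N; apply/asboolP; exists [::]; rewrite nil_free.
have Pb n : P n -> (n <= \rank (kermx M))%N.
  by move/asboolP=> [s [sC sf <-]]; apply: bound.
case: (ex_maxnP P0 Pb) => n /asboolP[s [sC sf sn]] nmax.
have spanC x : cone x -> x \in <<s>>%VS.
  move=> xC; apply: contraT => xs.
  suff /nmax : P n.+1 by rewrite ltnn.
  apply/asboolP; exists (x :: s); rewrite /= sn free_cons xs sf; split=> // y.
  by rewrite inE => /orP[/eqP ->|/sC].
exists s; split=> //; apply/eqP; rewrite eqn_leq bound //=.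
have [t [tW tf <-]] := free_balanced_exists.
rewrite -(eqnP sf) -(eqnP tf); apply/dimvS/span_subvP => x /tW.
by case/balanced_cone_diff=> y [z [/spanC ys /spanC zs ->]]; apply: rpredB.
Qed.

End Dimension.

Theorem theorem2p6 (R : realFieldType) (V E : finType) (src tgt : E -> V)
  (loopless : forall e, src e != tgt e) (C : E -> bool) :
  let d := red_deg src tgt C in
  let Edd := Ed src tgt d in
  exists k : nat, is_dim (alt_cone src tgt (R:=R) C) k /\
    (k%:Z = #|Edd|%:Z - #|V|%:Z + (nb_bip src tgt Edd)%:Z).
Proof.
move=> d Edd; exists (\rank (kermx (inc_mx R src tgt Edd))).
split; first exact: is_dim_cone.
have := rank_inc_mx R loopless Edd => /(congr1 Posz).
(* The left kernel has dimension the number of edges in [Ed] minus the rank. *)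
by rewrite PoszD mxrank_ker -subzn ?rank_leq_row // => <-; ring.
Qed.
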